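(* Let $b:\mathbb{R}\to\mathbb{R}$ be a convex non-decreasing function and let $m(x)=p(x)-\max_{1\le i\le I}\big[(a^i)^Tx+\alpha_i\big]$, where $p$ is a convex function on the convex set $\mathcal{D}\subseteq\mathbb{R}^n$ and $(a^i,\alpha_i)\in\mathbb{R}^{n+1}$ for $i=1,\dots,I$. Then the composite function $b\circ m$ is dc on $\mathcal{D}$.
   Context: A function on a convex set is dc (difference-of-convex) if it is the difference of two real-valued convex functions on that set. *)

(* Defs.v *)
From mathcomp Require Import all_boot all_order all_algebra.
From mathcomp Require Import boolp classical_sets reals numfun convex.

Set Implicit Arguments.
Unset Strict Implicit.
Unset Printing Implicit Defensive.

Import Order.TTheory GRing.Theory Num.Theory.

Local Open Scope classical_set_scope.
Local Open Scope ring_scope.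

(* A function on D is represented by a total function whose values outside D
   are irrelevant, hence the decomposition is only required on D. *)
Definition dc_on (R : realType) (E : lmodType R) (D : set E) (f : E -> R) :=
  exists g h : E -> R,
    [/\ convex_function D g, convex_function D h &
        {in D, forall x, f x = g x - h x}].

(* The default value of the iterated max is one of the u i, so that it does
   not affect the maximum. *)
Definition finmax (R : realType) (I : nat) (hI : (0 < I)%N)
    (u : 'I_I -> R) : R :=
  \big[Num.max/u (Ordinal hI)]_(i < I) u i.

(* Main.v *)
(* Since b is non-decreasing, b (p - max_i l_i) = min_i b (p - l_i), and each
   G_i = b (p - l_i) is convex because p - l_i is. A minimum of convex functions
   is dc: min_i G_i = \sum_i G_i - max_j \sum_(i != j) G_i. *)
Require Import Defs.
From mathcomp Require Import all_boot all_order all_algebra.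
From mathcomp Require Import boolp classical_sets reals numfun convex.
From mathcomp Require Import lra.
From mathcomp Require Import interval_inference.

Set Implicit Arguments.
Unset Strict Implicit.
Unset Printing Implicit Defensive.

Import Order.TTheory GRing.Theory Num.Theory.

Local Open Scope classical_set_scope.
Local Open Scope ring_scope.

Lemma finmax_ub (R : realType) (I : nat) (hI : (0 < I)%N) (u : 'I_I -> R)
    (i : 'I_I) :
  u i <= finmax hI u.
Proof. exact: le_bigmax. Qed.

(** Being a value of [u] holds for the default [u (Ordinal hI)] and is preserved by [Num.max], hence
    passes to the iterated maximum. *)
Lemma finmax_attained (R : realType) (I : nat) (hI : (0 < I)%N)
    (u : 'I_I -> R) :
  exists i, finmax hI u = u i.
Proof.
rewrite /finmax; elim/big_ind: _ => [|x y [i ->] [j ->]|i _]; last by exists i.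
  by exists (Ordinal hI).
by case: (leP (u i) (u j)) => _; [exists j | exists i].
Qed.

Lemma finmax_eq (R : realType) (I : nat) (hI : (0 < I)%N) (u : 'I_I -> R)
    (k : 'I_I) :
  (forall i, u i <= u k) -> finmax hI u = u k.
Proof.
move=> uk; apply/eqP; rewrite eq_le finmax_ub andbT.
by have [i ->] := finmax_attained hI u.
Qed.

Section ConvexFunctions.
Variables (R : realType) (E : lmodType R) (D : set E).

Lemma convex_function_sum (I : finType) (P : pred I) (G : I -> E -> R) :
  (forall i, convex_function D (G i)) ->
  convex_function D (fun x => \sum_(i | P i) G i x).
Proof.
move=> cG t x y xD yD; rewrite convRE !mulr_sumr -big_split /=.
by apply: ler_sum => i _; exact: cG.
Qed.

(** An index attaining the maximum at the convex combination gives a single [G i], whose convexity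
    inequality has its right-hand side bounded by the maxima at [x] and [y]. *)
Lemma convex_function_finmax (I : nat) (hI : (0 < I)%N) (G : 'I_I -> E -> R) :
  (forall i, convex_function D (G i)) ->
  convex_function D (fun x => finmax hI (G ^~ x)).
Proof.
move=> cG t x y xD yD.
have [i ->] := finmax_attained hI (G ^~ (conv t x y)).
apply: le_trans (cG i t x y xD yD) _; rewrite !convRE.
by apply: lerD; apply: ler_wpM2l; rewrite ?finmax_ub ?subr_ge0.
Qed.

Lemma convex_function_comp (b : R -> R) (f : E -> R) :
  convex_function (E := R^o) setT b -> nondecreasing_fun b ->
  convex_function D f -> convex_function D (b \o f).
Proof.
move=> cb ndb cf t x y xD yD; apply: le_trans (ndb _ _ (cf t x y xD yD)) _.
by apply: cb; rewrite in_setT.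
Qed.

(** Among the sums that omit one term, the largest omits the smallest term; subtracting it from the
    full sum leaves the minimum. The minimum is expressed through an index [k] attaining it, which
    may depend on [x]. *)
Lemma dc_on_min (I : nat) (hI : (0 < I)%N) (G : 'I_I -> E -> R) (f : E -> R) :
  (forall i, convex_function D (G i)) ->
  {in D, forall x, exists2 k, f x = G k x & forall i, G k x <= G i x} ->
  dc_on D f.
Proof.
move=> cG fmin.
exists (fun x => \sum_i G i x).
exists (fun x => finmax hI (fun j => \sum_(i | i != j) G i x)).
split; first exact: convex_function_sum.
- by apply: convex_function_finmax => j; exact: convex_function_sum.
move=> x xD; have [k -> Gk] := fmin x xD.
(* In this form, comparing two partial sums amounts to comparing the omitted terms in reverse
   order. *)
have sumE j : \sum_(i | i != j) G i x = \sum_i G i x - G j x.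
  by rewrite [in RHS](bigD1 j)//= addrAC subrr add0r.
rewrite (@finmax_eq _ _ _ _ k) ?sumE; first by rewrite opprB addrC subrK.
by move=> j; rewrite !sumE lerB.
Qed.

End ConvexFunctions.

(** An affine map satisfies the convexity inequality with equality, the weights summing to 1, so
    subtracting it preserves the inequality for [p]. *)
Lemma convex_function_sub_affine (R : realType) (n : nat) (D : set 'cV[R]_n)
    (p : 'cV[R]_n -> R) (a : 'cV[R]_n) (alpha : R) :
  convex_function D p ->
  convex_function D (fun x => p x - ((a^T *m x) 0 0 + alpha)).
Proof.
move=> cp t x y xD yD; have := cp t x y xD yD.
have -> : (a^T *m conv t x y) 0 0 =
    t%:num * (a^T *m x) 0 0 + (1 - t%:num) * (a^T *m y) 0 0.
  by rewrite mulmxDr -!scalemxAr !mxE.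
rewrite !convRE /unstable.onem => cpt; lra.
Qed.

Theorem proposition5 (R : realType) (n I : nat) (hI : (0 < I)%N)
    (b : R -> R)
    (b_convex : convex_function (E := R^o) setT b)
    (b_nondecreasing : nondecreasing_fun b)
    (D : set 'cV[R]_n) (D_convex : convex_set D)
    (p : 'cV[R]_n -> R) (p_convex : convex_function D p)
    (a : 'I_I -> 'cV[R]_n) (alpha : 'I_I -> R)
    (m : 'cV[R]_n -> R)
    (m_def : {in D, forall x,
       m x = p x - finmax hI (fun i => ((a i)^T *m x) 0 0 + alpha i)}) :
  dc_on D (b \o m).
Proof.
pose l i (x : 'cV[R]_n) := ((a i)^T *m x) 0 0 + alpha i.
apply: (@dc_on_min _ _ _ _ hI (fun i => b \o (fun x => p x - l i x))).
  by move=> i; apply: convex_function_comp => //; exact: convex_function_sub_affine.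
(* The index maximizing [l i x] minimizes [p x - l i x], and also [b (p x - l i x)] since [b] is
   non-decreasing. *)
move=> x xD; have [k lk] := finmax_attained hI (l ^~ x).
exists k => [|i] /=; first by rewrite m_def// -lk.
by apply: b_nondecreasing; rewrite lerB// -lk finmax_ub.
Qed.
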